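(* Let $(X,\mathcal A)$ be a $t$-$(v,k,\lambda)$ design with non-repeated blocks, $X=\{1,\dots,v\}$, with $b=|\mathcal A|$ blocks. For integers $a_s\in\{0,1,\dots,\lambda_s^t\}$, $s\in[t-1]$, such that $|\mathcal R|>\lambda_1$, the pair $(P,B)$ of arrays defined in the context forms a $(K,K',F,F',Z,Z',S)$-HpPDA with $$K=v,\quad F=b,\quad Z=\lambda_1,\quad K'=t,\quad F'=|\mathcal R|=\sum_{s=1}^{t-1}a_s\binom ts,\quad Z'=\sum_{s=1}^{t-1}a_s\binom{t-1}{s-1},\quad S=\sum_{s=1}^{t-1}a_s\binom{t}{s+1}.$$
   Context: Notation: $[n]=\{1,\dots,n\}$; $\binom{[t]}{s}$ also denotes the family of $s$-subsets of $[t]$. Design. For positive integers $v,k,\lambda,t$ with $v>k\ge t$, a $t$-$(v,k,\lambda)$ design is a pair $(X,\mathcal A)$ with $|X|=v$ (points) and $\mathcal A$ a collection of $k$-subsets of $X$ (blocks) such that every set of $t$ distinct points is contained in exactly $\lambda$ blocks. Put $\lambda_1=\lambda\binom{v-1}{t-1}/\binom{k-1}{t-1}$ and $\lambda_s^t=\lambda\binom{v-t}{k-s}/\binom{v-t}{k-t}$. PDA. For positive integers $K,F,Z,S$, a $[K,F,Z,S]$-PDA is an $F\times K$ array $(p_{j,k})$ with entries in $\{*\}\cup[S]$ such that: (C1) $*$ appears $Z$ times in each column; (C2) each integer of $[S]$ occurs at least once; (C3) if two distinct entries satisfy $p_{j_1,k_1}=p_{j_2,k_2}=s\in[S]$, then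 $j_1\ne j_2$, $k_1\neq k_2$ and $p_{j_1,k_2}=p_{j_2,k_1}=*$. Any set of $S$ distinct labels may be used in place of $[S]$; non-star entries are called integers. HpPDA. Let $K,K',F,F',Z,Z',S$ be integers with $K\ge K'$, $F\ge F'$, $Z<F'$. A $(K,K',F,F',Z,Z',S)$-HpPDA is a pair $(P,B)$ where $P$ is an $F\times K$ array with entries ''$*$'' or ''null'', each column having exactly $Z$ stars; $B$ is a $[K',F',Z',S]$-PDA; and for each set $\tau$ of $K'$ columns of $P$ there is a set $\zeta$ of $F'$ rows of $P$ such that the subarray $[P]_{\zeta\times\tau}$ (rows $\zeta$, columns $\tau$, listed in a suitable order) has its stars in exactly the same positions as $B$. Arrays. $P$ has rows indexed by the blocks $A\in\mathcal A$ and columns by points $i\in X$, with $P(A,i)=*$ if $i\in A$ and null otherwise. Let $\mathcal R=\bigcup_{s=1}^{t-1}\{(Y,i): Y\in\binom{[t]}{s},\ i\in[a_s]\}$. $B$ has rows indexed by $\mathcal R$ and columns by $[t]$, with $B((Y,i),j)=*$ if $j\in Y$ and $B((Y,i),j)=(Y\cup\{j\},i)$ if $j\notin Y$ (the pair $(Y\cup\{j\},i)$ serving as an integer label). *)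

(* Defs.v *)
From HB Require Import structures.
From mathcomp Require Import all_boot.

Set Implicit Arguments.
Unset Strict Implicit.
Unset Printing Implicit Defensive.

(* Blocks form a set of subsets of X, so they are non-repeated. *)
Definition is_design (t v k lambda : nat) (X : finType)
    (Bl : {set {set X}}) : Prop :=
  [/\ [/\ 0 < v, 0 < k, 0 < lambda & 0 < t],
      t <= k < v,
      #|X| = v,
      forall A : {set X}, A \in Bl -> #|A| = k &
      forall T : {set X}, #|T| = t ->
        #|[set A in Bl | T \subset A]| = lambda].

(* Both divisions are exact when a t-(v,k,lambda) design exists: lambda1 is the
   number of blocks through a point, lambda_st the number of blocks meeting a
   fixed t-set exactly in a fixed s-subset of it. *)
Definition lambda1 (t v k lambda : nat) : nat :=
  (lambda * 'C(v - 1, t - 1)) %/ 'C(k - 1, t - 1).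

Definition lambda_st (t v k lambda s : nat) : nat :=
  (lambda * 'C(v - t, k - s)) %/ 'C(v - t, k - t).

(* [None] is the star, [Some x] the integer (label) x.  Rows and columns are
   indexed by arbitrary finite types, and any S distinct labels may replace
   1, ..., S: they are listed in [lab]. *)
Definition is_PDA (K F Z S : nat) (Row Col : finType) (L : eqType)
    (p : Row -> Col -> option L) : Prop :=
  [/\ [/\ 0 < K, 0 < F, 0 < Z & 0 < S],
      #|Col| = K /\ #|Row| = F,
      forall c, #|[set r | p r c == None]| = Z,
      exists lab : seq L,
        [/\ uniq lab, size lab = S,
            forall r c x, p r c = Some x -> x \in lab &
            forall x, x \in lab -> exists r c, p r c = Some x] &
      forall r1 c1 r2 c2 x,
        (r1, c1) <> (r2, c2) -> p r1 c1 = Some x -> p r2 c2 = Some x ->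
        [/\ r1 <> r2, c1 <> c2, p r1 c2 = None & p r2 c1 = None]].

(* In P, [true] is the star and [false] is null.  The injections f and g list
   the columns tau and the rows zeta in the order that matches B. *)
Definition is_HpPDA (K K' F F' Z Z' S : nat)
    (RowP ColP RowB ColB : finType) (L : eqType)
    (P : RowP -> ColP -> bool) (B : RowB -> ColB -> option L) : Prop :=
  [/\ [/\ K' <= K, F' <= F & Z < F'],
      #|ColP| = K /\ #|RowP| = F,
      forall c, #|[set r | P r c]| = Z,
      is_PDA K' F' Z' S B &
      forall tau : {set ColP}, #|tau| = K' ->
        exists zeta : {set RowP}, #|zeta| = F' /\
        exists (f : ColB -> ColP) (g : RowB -> RowP),
          [/\ injective f, injective g,
              [set f c | c : ColB] = tau, [set g r | r : RowB] = zeta &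
              forall r c, P (g r) (f c) = (B r c == None)]].

Definition design_array (X : finType) (Bl : {set {set X}})
    (A : {A : {set X} | A \in Bl}) (i : X) : bool := i \in val A.

(* The pairs (Y, i) with Y a subset of [t], s = #|Y| in {1, ..., t-1}, and i
   in [a_s]; the sets [t] and [a_s] are 'I_t and 'I_(a s), counted from 0. *)
Definition hp_rows (t : nat) (a : nat -> nat) : finType :=
  {Y : {Y : {set 'I_t} | 0 < #|Y| < t} & 'I_(a #|val Y|)}.

Definition hp_array (t : nat) (a : nat -> nat) (r : hp_rows t a) (j : 'I_t) :
    option ({set 'I_t} * nat) :=
  let Y := val (tag r) in
  if j \in Y then None else Some (j |: Y, nat_of_ord (tagged r)).

(* Main.v *)
(* Write N(I, J) for the number of blocks containing I and disjoint from J.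
   Counting pairs (x, A) with x outside I and x |: I inside A gives N(I, set0) by
   induction downwards from #|I| = t, and
     N(I, x |: J) = N(I, J) - N(x |: I, J)
   together with Pascal's rule then gives N(I, J) whenever #|I| + #|J| <= t.
   Taking J = T :\: Y: exactly lambda_s^t blocks meet a t-set T of columns in a
   given s-subset Y.  As a_s <= lambda_s^t, the rows (Y, i) of B can be sent
   injectively to blocks meeting T in Y, whose stars inside T are exactly Y. *)

Require Import Defs.
From HB Require Import structures.
From mathcomp Require Import all_boot.
From mathcomp Require Import zify ring.

Set Implicit Arguments.
Unset Strict Implicit.
Unset Printing Implicit Defensive.

(** * Block counts in a design *)

Lemma mul_bin_trinomial (n m p : nat) :
  p <= m -> m <= n -> 'C(n, m) * 'C(m, p) = 'C(n, p) * 'C(n - p, m - p).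
Proof.
move=> le_pm le_mn; have le_pn := leq_trans le_pm le_mn.
have := bin_fact (leq_sub2r p le_mn); rewrite subnBA // subnK // => E.
(* Both sides become the factorial of [n] once multiplied by the factorials of [p], [m - p] and
   [n - m]. *)
apply/eqP; rewrite -(eqn_pmul2r (fact_gt0 p)) -(eqn_pmul2r (fact_gt0 (m - p))).
rewrite -(eqn_pmul2r (fact_gt0 (n - m))); apply/eqP; transitivity n`!.
  by rewrite -(bin_fact le_mn) -(bin_fact le_pm); ring.
by rewrite -(bin_fact le_pn) -E; ring.
Qed.

(** Double counting of pairs [(x, A)]: a block [A] above [I] admits exactly the [k - #|I|] points
    [x] of [A] outside [I]. *)
Lemma sum_card_blocks_above (X : finType) (Bl : {set {set X}}) (k : nat)
    (I : {set X}) :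
  (forall A, A \in Bl -> #|A| = k) ->
  \sum_(x in ~: I) #|[set A in Bl | x |: I \subset A]| =
    (k - #|I|) * #|[set A in Bl | I \subset A]|.
Proof.
move=> Blk; under eq_bigr => x _ do rewrite -sum1_card.
rewrite (exchange_big_dep (mem [set A in Bl | I \subset A])) /=; last first.
  by move=> x A _; rewrite !inE subUset => /andP[-> /andP[_ ->]].
rewrite mulnC -sum_nat_const; apply: eq_bigr => A.
rewrite inE => /andP[ABl IA]; rewrite sum1_card.
rewrite -(Blk A ABl) -(setIidPr IA) -cardsD (setIidPr IA).
by apply: eq_card => x; rewrite !inE unfold_in !inE ABl subUset sub1set IA andbT.
Qed.

(** Downward induction from [#|I| = t], where the design axiom applies. The product form avoids any
    division. *)
Lemma card_blocks_above (t v k lambda : nat) (X : finType)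
    (Bl : {set {set X}}) (I : {set X}) :
  is_design t v k lambda Bl -> #|I| <= t ->
  #|[set A in Bl | I \subset A]| * 'C(k - #|I|, t - #|I|) =
    lambda * 'C(v - #|I|, t - #|I|).
Proof.
case=> _ /andP[le_tk lt_kv] cX Blk desT.
have [n] := ubnP (t - #|I|); elim: n I => // n IHn I lt_n.
rewrite leq_eqVlt => /orP[/eqP cI | lt_It].
  by rewrite desT // cI subnn !bin0.
have cC : #|~: I| = v - #|I| by rewrite cardsCs setCK cX.
have /eqP := sum_card_blocks_above I Blk.
(* This positive factor is the one that the induction hypothesis attaches to each [x |: I]. Then
   [mul_bin_diag] absorbs [v - #|I|] and [k - #|I|], and a common [t - #|I|] cancels. *)
rewrite -(eqn_pmul2r (m := 'C(k - #|I|.+1, t - #|I|.+1))); last first.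
  by rewrite bin_gt0 leq_sub2r.
rewrite big_distrl /= (eq_bigr (fun=> lambda * 'C(v - #|I|.+1, t - #|I|.+1))).
  rewrite sum_nat_const cC !subnS mulnCA mul_bin_diag prednK ?subn_gt0 //.
  rewrite mulnAC mul_bin_diag prednK ?subn_gt0 // mulnCA -mulnA.
  by rewrite eqn_pmul2l ?subn_gt0 // => /eqP ->; rewrite mulnC.
move=> x; rewrite inE => xI.
have cxI : #|x |: I| = #|I|.+1 by rewrite cardsU1 xI.
by rewrite -cxI IHn ?cxI //; lia.
Qed.

(** Induction on [#|J|]: moving a point from [J] to [I] preserves [#|I| + #|J|], and both the count
    and the binomial obey Pascal's recursion. *)
Lemma card_blocks_between (t v k lambda : nat) (X : finType)
    (Bl : {set {set X}}) (I J : {set X}) :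
  is_design t v k lambda Bl -> [disjoint I & J] -> #|I| + #|J| <= t ->
  #|[set A in Bl | (I \subset A) && (J \subset ~: A)]| * 'C(v - t, k - t) =
    lambda * 'C(v - #|I| - #|J|, k - #|I|).
Proof.
move=> des; have [_ /andP[le_tk lt_kv] cX Blk _] := des.
have [n] := ubnP #|J|; elim: n => // n IHn in I J *.
rewrite ltnS => le_J dIJ le_IJ.
have [-> | [x xJ]] := set_0Vmem J.
  rewrite cards0 subn0; have le_It : #|I| <= t by lia.
  (* With this factor, [card_blocks_above] applies on the left, and the trinomial identity turns the
     right side into a multiple of ['C(v - t, k - t)]. *)
  apply/eqP; rewrite -(eqn_pmul2r (m := 'C(k - #|I|, t - #|I|))); last first.
    by rewrite bin_gt0 leq_sub2r.
  apply/eqP; rewrite mulnAC -[RHS]mulnA.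
  rewrite mul_bin_trinomial ?leq_sub2r ?(ltnW lt_kv) //.
  rewrite !subnBA ?leq_sub2r // !subnK; [rewrite mulnA|lia..].
  rewrite -(card_blocks_above des le_It); congr (_ * _ * _).
  by apply: eq_card => A; rewrite !inE sub0set andbT.
have xI : x \notin I by apply: contraTN xJ => xI; rewrite (disjointFr dIJ xI).
have cJ : #|J| = #|J :\ x|.+1 by rewrite (cardsD1 x J) xJ.
have cxI : #|x |: I| = #|I|.+1 by rewrite cardsU1 xI.
have dIJx : [disjoint I & J :\ x] by apply: disjointWr dIJ; apply: subsetDl.
have dxIJx : [disjoint x |: I & J :\ x].
  by rewrite -setI_eq0 setIUl setU_eq0 !setI_eq0 dIJx disjoints1 !inE eqxx.
have := IHn I (J :\ x) _ dIJx; rewrite -cJ => /(_ le_J ltac:(lia)).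
(* Among the blocks above [I] that avoid [J :\ x], those with [x] are above [x |: I], and those
   without [x] avoid all of [J]. *)
rewrite -(cardsID [set A : {set X} | x \in A]) mulnDl.
have -> : [set A in Bl | (I \subset A) && (J :\ x \subset ~: A)]
    :&: [set A : {set X} | x \in A]
  = [set A in Bl | (x |: I \subset A) && (J :\ x \subset ~: A)].
  apply/setP=> A; rewrite !inE subUset sub1set.
  by case: (x \in A); rewrite ?andbT ?andbF.
have -> : [set A in Bl | (I \subset A) && (J :\ x \subset ~: A)]
    :\: [set A : {set X} | x \in A]
  = [set A in Bl | (I \subset A) && (J \subset ~: A)].
  apply/setP=> A; rewrite !inE -{2}(setD1K xJ) subUset sub1set inE.
  by case: (x \in A); rewrite ?andbF.
rewrite (IHn (x |: I) (J :\ x)) ?cxI //;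
  [|by rewrite -cJ|by rewrite addSnnS -cJ].
rewrite cJ.
have -> : v - #|I| - #|J :\ x| = (v - #|I|.+1 - #|J :\ x|).+1 by lia.
have -> : k - #|I| = (k - #|I|.+1).+1 by lia.
have -> : v - #|I| - #|J :\ x|.+1 = v - #|I|.+1 - #|J :\ x| by lia.
by rewrite binS mulnDr [RHS]addnC => /addnI.
Qed.

(** For [J = T :\: Y] the two sizes add up to [t], so the top index is [v - t]; the product form
    makes the division in [lambda_st] exact. *)
Lemma card_blocks_meeting (t v k lambda : nat) (X : finType)
    (Bl : {set {set X}}) (Y T : {set X}) :
  is_design t v k lambda Bl -> #|T| = t -> Y \subset T ->
  #|[set A in Bl | A :&: T == Y]| = lambda_st t v k lambda #|Y|.
Proof.
move=> des cT YT; have [_ /andP[le_tk lt_kv] cX _ _] := des.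
have le_Yt : #|Y| <= t by rewrite -cT subset_leq_card.
have cD : #|T :\: Y| = t - #|Y| by rewrite cardsD (setIidPr YT) cT.
have := card_blocks_between (I := Y) (J := T :\: Y) des.
rewrite cD subnKC // subnBA // subnK; last by lia.
rewrite /lambda_st => <- //; last first.
  by rewrite -setI_eq0 setDE setICA setICr setI0.
rewrite mulnK ?bin_gt0 ?leq_sub2r ?(ltnW lt_kv) //.
apply: eq_card => A; rewrite !inE; congr (_ && _); apply/eqP/andP.
  move=> <-; rewrite subsetIl; split=> //; apply/subsetP=> x.
  by rewrite !inE; case: (x \in T); rewrite ?andbT ?andbF.
case=> /subsetP YA /subsetP JA; apply/setP=> x; rewrite !inE.
have := JA x; have := YA x; have := subsetP YT x; rewrite !inE.
by case: (x \in Y); case: (x \in T); case: (x \in A) => //= H1 H2 H3;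
  rewrite ?H1 ?H2 ?H3 // ?(H3 isT) //; move: (H1 isT) (H2 isT) (H3 isT).
Qed.

Lemma card_blocks_point (t v k lambda : nat) (X : finType)
    (Bl : {set {set X}}) (x : X) :
  is_design t v k lambda Bl ->
  #|[set A in Bl | x \in A]| = lambda1 t v k lambda.
Proof.
move=> des; have [[_ _ _ t_gt0] /andP[le_tk lt_kv] _ _ _] := des.
have := card_blocks_above (I := [set x]) des; rewrite cards1 => /(_ t_gt0).
rewrite /lambda1 => <-; rewrite mulnK ?bin_gt0 ?leq_sub2r //.
by apply: eq_card => A; rewrite !inE sub1set.
Qed.

(** * Counting subsets and rows by cardinality *)

(** Groups the sets by size. A trivial [Q] serves for the numbers of rows and of labels, and
    membership of a column for the stars in that column. *)
Lemma sum_card_range (T : finType) (Q : pred {set T}) (F : nat -> nat)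
    (m n : nat) :
  \sum_(Y : {set T} | (m <= #|Y| < n) && Q Y) F #|Y| =
  \sum_(m <= s < n) F s * #|[set Y : {set T} | Q Y & #|Y| == s]|.
Proof.
have cF (s : nat) : F s * #|[set Y : {set T} | Q Y & #|Y| == s]|
    = \sum_(Y : {set T} | Q Y && (#|Y| == s)) F #|Y|.
  rewrite mulnC -sum_nat_const; apply: eq_big => [Y|Y]; rewrite !inE //.
  by case/andP=> _ /eqP->.
under [RHS]eq_bigr => s _ do rewrite cF.
rewrite (exchange_big_dep Q) /=; last by move=> s Y _ /andP[].
rewrite big_mkcondl; apply: eq_bigr => Y QY.
under eq_bigl => s do rewrite QY.
case: ifP => [mYn | mYn].
  rewrite big_mkcond (bigD1_seq #|Y|) ?mem_index_iota ?iota_uniq //= eqxx.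
  by rewrite big1 ?addn0 // => s /negPf; rewrite eq_sym => ->.
rewrite big_nat_cond big_pred0 // => s.
by apply/andP => -[+ /eqP eYs]; rewrite -eYs mYn.
Qed.

Lemma card_hp_rows (t : nat) (a : nat -> nat) (Q : pred {set 'I_t}) :
  #|[set r : hp_rows t a | Q (val (tag r))]| =
  \sum_(1 <= s < t) a s * #|[set Y : {set 'I_t} | Q Y & #|Y| == s]|.
Proof.
rewrite -sum_card_range -sum1_card.
rewrite (big_sub_cond (fun Y : {set 'I_t} => 0 < #|Y| < t)).
transitivity (\sum_(Y : {Y : {set 'I_t} | 0 < #|Y| < t} | Q (val Y))
  \sum_(i < a #|val Y|) 1).
  by rewrite sig_big_dep; apply: eq_bigl => r; rewrite inE andbT.
by apply: eq_bigr => Y _; rewrite sum1_card card_ord.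
Qed.

Lemma card_set_of_card (T : finType) (s : nat) :
  #|[set Y : {set T} | #|Y| == s]| = 'C(#|T|, s).
Proof.
by rewrite -cardsT -cards_draws; apply: eq_card => Y; rewrite !inE subsetT.
Qed.

(** By Pascal's rule: the sets avoiding [x] are the draws from [~: [set x]], and removing them from
    all sets of size [s.+1] leaves the required number. *)
Lemma card_set_of_card_mem (T : finType) (x : T) (s : nat) :
  #|[set Y : {set T} | x \in Y & #|Y| == s.+1]| = 'C(#|T|.-1, s).
Proof.
have cT : #|T| = #|~: [set x]|.+1 by rewrite -cardsT (cardsD1 x) inE setTD.
apply/(@addnI 'C(#|T|.-1, s.+1)); rewrite cT /= -binS -cT -card_set_of_card.
rewrite -cards_draws.
rewrite -(cardsID [set Y : {set T} | x \in Y] [set Y : {set T} | #|Y| == s.+1]).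
rewrite [RHS]addnC; congr (_ + _); apply: eq_card => Y; rewrite !inE.
  by rewrite -disjoints_subset disjoint_sym disjoints1.
by rewrite andbC.
Qed.

(** * The array B is a PDA *)

(** The row [r0] supplies the positivity conditions: its set is neither empty nor full, so it has
    both a star and an integer. *)
Lemma hp_array_PDA (t : nat) (a : nat -> nat) (r0 : hp_rows t a) :
  is_PDA t #|hp_rows t a| (\sum_(1 <= s < t) a s * 'C(t - 1, s - 1))
    (\sum_(1 <= s < t) a s * 'C(t, s + 1)) (@hp_array t a).
Proof.
set Z := (X in is_PDA _ _ X _ _); set S := (X in is_PDA _ _ _ X _).
have starE (r : hp_rows t a) j : (hp_array r j == None) = (j \in val (tag r)).
  by rewrite /hp_array; case: ifP.
have cZ j : #|[set r | @hp_array t a r j == None]| = Z.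
  have -> : [set r | @hp_array t a r j == None] =
      [set r : hp_rows t a | j \in val (tag r)].
    by apply/setP=> r; rewrite !inE starE.
  rewrite (card_hp_rows a (fun Y => j \in Y)).
  apply: eq_big_nat => s /andP[s_gt0 _].
  by case: s s_gt0 => // s _; rewrite card_set_of_card_mem !subn1 card_ord.
have le_card (W : {set 'I_t}) : #|W| <= t.
  by rewrite -[leqRHS]card_ord max_card.
(* A label set [W] is a row set plus one point, so its size runs from 2 to [t], and [i] is bounded
   by [a] at [#|W|.-1]. *)
pose lab := [seq (W, i)
  | W : {set 'I_t} <- enum [set W : {set 'I_t} | 2 <= #|W| < t.+1],
    i : nat <- iota 0 (a #|W|.-1)].
have labP W i : ((W, i) \in lab) = (2 <= #|W|) && (i < a #|W|.-1).
  apply/allpairsPdep/andP => [[W' [i' [+ + [-> ->]]]] | [W2 ia]].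
    by rewrite mem_enum inE mem_iota => /andP[-> _].
  exists W, i; rewrite mem_enum inE mem_iota W2 ia; split=> //.
  by rewrite ltnS le_card.
have mem_lab r j x : @hp_array t a r j = Some x -> x \in lab.
  rewrite /hp_array; case: ifP => // jY [<-]; rewrite labP cardsU1 jY /=.
  by rewrite ltnS ltn_ord; case/andP: (valP (tag r)) => ->.
have lab_mem x : x \in lab -> exists r j, @hp_array t a r j = Some x.
  case: x => W i; rewrite labP => /andP[W2].
  (* Any [j] in [W] works: row [(W :\ j, i)] carries the label [(W, i)] in column [j]. *)
  have [j jW] : exists j, j \in W by apply/set0Pn; rewrite -card_gt0; lia.
  have cW : #|W| = #|W :\ j|.+1 by rewrite (cardsD1 j W) jW.
  have YP : 0 < #|W :\ j| < t.
    by have := le_card W; lia.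
  rewrite cW /= => ia.
  pose Y : {Y : {set 'I_t} | 0 < #|Y| < t} := exist _ (W :\ j) YP.
  pose T (Y : {Y : {set 'I_t} | 0 < #|Y| < t}) := 'I_(a #|val Y|).
  exists (existT T Y (Ordinal ia)).
  by exists j; rewrite /hp_array /= !inE eqxx /= setD1K.
have size_lab : size lab = S.
  rewrite size_allpairs_dep sumnE big_map big_enum /=.
  under eq_bigr => W _ do rewrite size_iota.
  under eq_bigl => W do rewrite inE -[_ && _]andbT.
  rewrite (sum_card_range predT (fun s => a s.-1)) big_add1 /=.
  apply: eq_bigr => s _; rewrite /= addn1 -[t in 'C(t, _)]card_ord.
  by rewrite -card_set_of_card.
have [j0 j0Y] : exists j, j \in val (tag r0).
  by apply/set0Pn; rewrite -card_gt0; case/andP: (valP (tag r0)).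
have [j1] : exists j, j \in ~: val (tag r0).
  apply/set0Pn; rewrite -card_gt0 cardsCs setCK card_ord subn_gt0.
  by case/andP: (valP (tag r0)).
rewrite inE => j1Y.
split=> //.
- split; first by apply: leq_ltn_trans (ltn_ord j0).
  + by apply/card_gt0P; exists r0.
  + by rewrite -(cZ j0); apply/card_gt0P; exists r0; rewrite inE starE.
  + rewrite -size_lab lt0n size_eq0; apply/eqP=> lab0.
    have := mem_lab r0 j1; rewrite /hp_array (negPf j1Y) lab0.
    by move=> /(_ _ erefl).
- by rewrite card_ord.
- exists lab; split=> //.
  apply: allpairs_uniq_dep => [||[W i] [W' i'] _ _ [-> ->] //].
    exact: enum_uniq.
  by move=> W _; apply: iota_uniq.
move=> r1 c1 r2 c2 x ne12; rewrite /hp_array.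
case: ifP => // c1Y [<-]; case: ifP => // c2Y [eqY eqi].
have [eqc | nec] := eqVneq c1 c2.
  (* Within one column, deleting it from the common label set recovers the row set, so the two cells
     coincide. *)
  case: ne12; rewrite -eqc in eqY c2Y *; congr (_, _).
  have {}eqY : val (tag r1) = val (tag r2).
    by rewrite -(setU1K (negbT c1Y)) -eqY setU1K ?c2Y.
  case: r1 r2 eqY eqi {c1Y c2Y} => [Y1 i1] [Y2 i2] /= /val_inj eqY.
  by case: Y2 / eqY i2 => i2 /val_inj ->.
(* The common label set contains both columns, so each row set contains the column of the other
   cell. This gives the two stars and separates the rows. *)
have c2r1 : c2 \in val (tag r1).
  by have := setU11 c2 (val (tag r2)); rewrite eqY !inE eq_sym (negPf nec).
have c1r2 : c1 \in val (tag r2).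
  by have := setU11 c1 (val (tag r1)); rewrite -eqY !inE (negPf nec).
split; rewrite ?c2r1 ?c1r2 //; last exact/eqP.
by move=> eqr; rewrite eqr c1r2 in c1Y.
Qed.

(** * Copies of B inside P *)

Lemma design_array_subarray (t v k lambda : nat) (X : finType)
    (Bl : {set {set X}}) (a : nat -> nat) (T : {set X}) :
  is_design t v k lambda Bl ->
  (forall s, 1 <= s <= t - 1 -> a s <= lambda_st t v k lambda s) ->
  #|T| = t ->
  exists (f : 'I_t -> X) (g : hp_rows t a -> {A : {set X} | A \in Bl}),
    [/\ injective f, injective g, [set f c | c : 'I_t] = T &
        forall r c, design_array (g r) (f c) = (hp_array r c == None)].
Proof.
move=> des ha cT.
pose f (c : 'I_t) := enum_val (cast_ord (esym cT) c).
have f_inj : injective f by move=> c d /enum_val_inj /cast_ord_inj.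
have fT c : f c \in T by apply: enum_valP.
have imfT : [set f c | c : 'I_t] = T.
  apply/eqP; rewrite eqEcard card_imset // card_ord cT leqnn andbT.
  by apply/subsetP=> _ /imsetP[c _ ->].
pose M (Y : {set 'I_t}) := [set A in Bl | A :&: T == f @: Y].
(* Row [(Y, i)] goes to the [i]-th block whose trace on [T] is [f @: Y]. The default [set0] is never
   reached, by [lt_size]. *)
pose h (r : hp_rows t a) := nth set0 (enum (M (val (tag r)))) (tagged r).
have lt_size (r : hp_rows t a) : tagged r < size (enum (M (val (tag r)))).
  have /andP[Y_gt0 Y_lt] := valP (tag r).
  rewrite -cardE (card_blocks_meeting des cT); last first.
    by apply/subsetP=> _ /imsetP[c _ ->].
  by rewrite card_imset //; apply: leq_trans (ltn_ord _) (ha _ _);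
    rewrite Y_gt0 leq_subRL ?add1n // (leq_ltn_trans _ Y_lt).
have hM r : h r \in M (val (tag r)) by rewrite -mem_enum mem_nth.
have hBl r : h r \in Bl by have := hM r; rewrite inE => /andP[].
have hT r : h r :&: T = f @: val (tag r).
  by have := hM r; rewrite inE => /andP[_ /eqP].
exists f, (fun r => exist _ (h r) (hBl r)); split=> //.
(* The trace of the block on [T] recovers [Y]; the enumeration has no repetition, so it recovers
   [i]. *)
- move=> r1 r2 /(congr1 val) /= eqh.
  have eqY : val (tag r1) = val (tag r2).
    by apply: (imset_inj f_inj); rewrite -!hT eqh.
  move: eqh (lt_size r1) (lt_size r2); rewrite /h.
  case: r1 r2 eqY => [Y1 i1] [Y2 i2] /= /val_inj eqY.
  case: Y2 / eqY i2 => i2 /eqP + lt1 lt2.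
  by rewrite nth_uniq ?enum_uniq // => /eqP/val_inj ->.
move=> r c; rewrite /design_array /hp_array /=.
have -> : (f c \in h r) = (c \in val (tag r)).
  by rewrite -(mem_imset _ _ f_inj) -hT inE fT andbT.
by case: ifP.
Qed.

Theorem theorem9 (t v k lambda b : nat) (Bl : {set {set 'I_v}}) (a : nat -> nat)
    (hdesign : is_design t v k lambda Bl)
    (hb : b = #|Bl|)
    (ha : forall s, 1 <= s <= t - 1 -> a s <= lambda_st t v k lambda s)
    (hR : lambda1 t v k lambda < #|hp_rows t a|) :
  #|hp_rows t a| = \sum_(1 <= s < t) a s * 'C(t, s) /\
  is_HpPDA v t b #|hp_rows t a| (lambda1 t v k lambda)
    (\sum_(1 <= s < t) a s * 'C(t - 1, s - 1))
    (\sum_(1 <= s < t) a s * 'C(t, s + 1))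
    (@design_array _ Bl) (@hp_array t a).
Proof.
have [_ /andP[le_tk lt_kv] cX _ _] := hdesign.
have le_tv : t <= v by lia.
have cBl : #|{: {A : {set 'I_v} | A \in Bl}}| = b by rewrite card_sig hb.
split.
  have -> : #|hp_rows t a| = #|[set r : hp_rows t a | predT (val (tag r))]|.
    by apply: eq_card => r; rewrite inE.
  rewrite card_hp_rows; apply: eq_bigr => s _.
  by rewrite -[t in 'C(t, _)]card_ord -card_set_of_card.
have sub T := design_array_subarray (T := T) hdesign ha.
split=> //.
- split=> //.
  (* The bound on the number of rows comes from the injection [g] attached to any single [t]-set of
     points. *)
  have [T] : exists T : {set 'I_v}, #|T| = t.
    exists [set widen_ord le_tv i | i : 'I_t].
    by rewrite card_imset ?card_ord // => i j /(congr1 val) /= /val_inj.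
  by case/sub=> f [g [_ g_inj _ _]]; rewrite -cBl; apply: leq_card g_inj.
- move=> i; rewrite -(card_blocks_point i hdesign).
  rewrite -(card_imset _ val_inj); apply: eq_card => A; rewrite inE.
  apply/imsetP/andP => [[B + ->]|[ABl iA]].
    by rewrite inE; split=> //; apply: valP.
  by exists (exist _ A ABl); rewrite ?inE.
(* [hR] makes the row set nonempty, which yields the row [r0] required for B. *)
- have /card_gt0P[r0 _] : 0 < #|hp_rows t a| by apply: leq_ltn_trans hR.
  exact: hp_array_PDA.
move=> T /sub[f [g [f_inj g_inj fT fg]]].
exists [set g r | r : hp_rows t a]; split; first by rewrite card_imset.
by exists f, g.
Qed.
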